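(* Let $k,\ell,n$ be positive integers, let $\sigma\in S_n$ and let $(P,Q)$ be the pair of standard Young tableaux corresponding to $\sigma$ under the RSK correspondence. Then $\sigma$ is $(k,\ell)$-bicrucial if and only if all of the following hold: (1) the number of columns in $P$ (and $Q$) is $k-1$; (2) the number of rows in $P$ (and $Q$) is $\ell-1$; (3) $P$ contains an increasing sequence of elements $p_{1,k-1}<p_{2,j_2}<\cdots<p_{\ell-1,j_{\ell-1}}$ for some column indices $j_2,\ldots,j_{\ell-1}$; (4) $P$ contains an increasing sequence of elements $p_{\ell-1,1}<p_{i_2,2}<\cdots<p_{i_{k-1},k-1}$ for some row indices $i_2,\ldots,i_{k-1}$.
   Context: $S_n$ is the set of permutations $\sigma=\sigma_1\cdots\sigma_n$ of $\{1,\ldots,n\}$ in one-line notation. The patterns $12\cdots m$ and $m(m-1)\cdots 1$ are denoted $i_m$ and $d_m$; a permutation contains $i_m$ (resp. $d_m$) if it has an increasing (resp. decreasing) subsequence of length $m$, and avoids it otherwise. For $1\le t\le n+1$ put $e_t(x)=x$ if $x<t$ and $e_t(x)=x+1$ if $x\ge t$. The extensions of $\sigma\in S_n$ to the right are the permutations $e_t(\sigma_1)\cdots e_t(\sigma_n)\,t$, and the extensions to the left are the permutations $t\,e_t(\sigma_1)\cdots e_t(\sigma_n)$, $1\le t\le n+1$. A permutation is $(k,\ell)$-right-crucial (resp. $(k,\ell)$-left-crucial) if it avoids $i_k$ and $d_\ell$ but each of its extensions to the right (resp. left) contains $i_k$ or $d_\ell$. It is $(k,\ell)$-bicrucial if it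 is both $(k,\ell)$-right-crucial and $(k,\ell)$-left-crucial. RSK: $P$ is the insertion tableau obtained by row-inserting $\sigma_1,\ldots,\sigma_n$ successively into the empty tableau, and $Q$ is the recording tableau. $p_{i,j}$ denotes the entry of $P$ in row $i$ (from the top) and column $j$ (from the left). *)

(* Defs.v *)
From mathcomp Require Import all_boot all_fingroup.

Set Implicit Arguments.
Unset Strict Implicit.
Unset Printing Implicit Defensive.

(* A permutation of {1, ..., n} is an element s of 'S_n, which acts on
   {0, ..., n-1}; the shift by one takes place in its one-line word. *)
Definition one_line n (s : 'S_n) : seq nat := [seq (s i).+1 | i : 'I_n].

Definition contains_incr m n (s : 'S_n) : Prop :=
  exists u : seq nat, [/\ subseq u (one_line s), size u = m & sorted ltn u].

Definition contains_decr m n (s : 'S_n) : Prop :=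
  exists u : seq nat, [/\ subseq u (one_line s), size u = m & sorted gtn u].

(* [lift_perm i t s] sends position i to the value t and follows s at the
   other positions, its values being renumbered by [lift t], that is, values
   at least t are increased by one; see [one_line_extend_right] and
   [one_line_extend_left] for the one-line words. *)
Definition extend_right n (t : 'I_n.+1) (s : 'S_n) : 'S_n.+1 :=
  lift_perm ord_max t s.

Definition extend_left n (t : 'I_n.+1) (s : 'S_n) : 'S_n.+1 :=
  lift_perm ord0 t s.

Definition right_crucial k l n (s : 'S_n) : Prop :=
  [/\ ~ contains_incr k s, ~ contains_decr l s
    & forall t : 'I_n.+1,
        contains_incr k (extend_right t s) \/
        contains_decr l (extend_right t s)].

Definition left_crucial k l n (s : 'S_n) : Prop :=
  [/\ ~ contains_incr k s, ~ contains_decr l s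
    & forall t : 'I_n.+1,
        contains_incr k (extend_left t s) \/
        contains_decr l (extend_left t s)].

Definition bicrucial k l n (s : 'S_n) : Prop :=
  right_crucial k l s /\ left_crucial k l s.

(* A tableau is the list of its rows, from top to bottom. *)
Definition tableau := seq (seq nat).

(* Row insertion of x into T, paired with the (0-based) index of the row that
   receives the new cell. In each row the leftmost entry y > x, if any, is
   replaced by x and then inserted into the next row; otherwise x is
   appended, since [find] then returns the size of the row. *)
Fixpoint row_insert (x : nat) (T : tableau) : tableau * nat :=
  if T is r :: T' then
    let j := find (ltn x) r in
    let r' := set_nth 0 r j x in
    if j < size r then
      let: (T'', i) := row_insert (nth 0 r j) T' in (r' :: T'', i.+1)
    else (r' :: T', 0)
  else ([:: [:: x]], 0).

Definition append_cell (Q : tableau) (i m : nat) : tableau :=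
  set_nth [::] Q i (rcons (nth [::] Q i) m).

(* xm = (x, m): the letter x is inserted at step m. *)
Definition rsk_step (PQ : tableau * tableau) (xm : nat * nat) :
    tableau * tableau :=
  let: (P', i) := row_insert xm.1 PQ.1 in (P', append_cell PQ.2 i xm.2).

Definition rsk n (s : 'S_n) : tableau * tableau :=
  foldl rsk_step ([::], [::]) (zip (one_line s) (iota 1 n)).

Definition num_rows (T : tableau) : nat := size T.

(* The first row of a Young tableau is its longest one. *)
Definition num_cols (T : tableau) : nat := size (head [::] T).

(* Rows and columns are numbered from 1. *)
Definition is_cell (T : tableau) (i j : nat) : bool :=
  (0 < i <= num_rows T) && (0 < j <= size (nth [::] T i.-1)).

Definition entry (T : tableau) (i j : nat) : nat :=
  nth 0 (nth [::] T i.-1) j.-1.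

Definition shift_from (t x : nat) : nat := if x < t then x else x.+1.

Lemma one_line_extend_right n (t : 'I_n.+1) (s : 'S_n) :
  one_line (extend_right t s) =
  rcons [seq shift_from t.+1 x | x <- one_line s] t.+1.
Proof.
rewrite /one_line /extend_right /image_mem enum_ordSr map_rcons lift_perm_id.
congr rcons; rewrite -!map_comp; apply: eq_map => i /=.
have -> : widen_ord (leqnSn n) i = lift ord_max i.
  by apply: val_inj; exact: esym (lift_max i).
rewrite lift_perm_lift /= /bump /shift_from ltnS.
by case: leqP.
Qed.

Lemma one_line_extend_left n (t : 'I_n.+1) (s : 'S_n) :
  one_line (extend_left t s) =
  t.+1 :: [seq shift_from t.+1 x | x <- one_line s].
Proof.
rewrite /one_line /extend_left /image_mem enum_ordSl /= lift_perm_id.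
congr cons; rewrite -!map_comp; apply: eq_map => i /=.
rewrite lift_perm_lift /= /bump /shift_from ltnS.
by case: leqP.
Qed.

(* Main.v *)
Require Import Defs.
From mathcomp Require Import all_boot all_fingroup zify.

(** The proof rests on a refinement of the Greene--Schensted theorem. Call two
    words equivalent when, for every interval I and every m, they agree on the
    existence of an increasing, and of a decreasing, subsequence of length m
    with all its values in I. This relation is a congruence for concatenation
    ([chain_equiv_cat]) and contains Knuth's elementary moves, so that row
    insertion of x into T replaces the reading word of T, followed by x, by an
    equivalent word ([row_insertP]). Hence the one-line word of sigma is
    equivalent to the reading word of P ([rsk_spec]), and every question about
    monotone subsequences of sigma with bounded values can be asked of P.

    In P such questions are geometric. A decreasing subsequence of the reading
    word climbs to a new row at each step and an increasing one moves to a new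
    column at each step. So if P has r rows and c columns, the longest
    decreasing and increasing subsequences have lengths r and c, and those of
    length r (resp. c) pick one cell from each row (resp. column); see
    [full_decreasing_chainP] and [full_increasing_chainP]. Moreover the
    smallest possible last value of an increasing subsequence of length c is
    the end of the first row, and the smallest possible first value of a
    decreasing subsequence of length r is the end of the first column.

    The extension of sigma to the right by t contains i_k exactly when sigma
    has an increasing subsequence of length k - 1 with values below t, and d_l
    exactly when it has a decreasing subsequence of length l - 1 with values
    at least t. The first condition says that t exceeds p := p_{1,k-1}, and
    the second one weakens as t decreases; so every t is covered if and only if
    t = p is covered by the second condition ([threshold]), that is, if and
    only if there is a decreasing subsequence of length l - 1 with values at
    least p. In P this is an increasing sequence of entries, one per row, all
    at least p, and the entry of row 1 must then be p itself. Extensions to the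
    left are treated in the same way, with rows and columns exchanged and the
    corner p_{l-1,1} in the place of p_{1,k-1}. *)

Set Implicit Arguments.
Unset Strict Implicit.
Unset Printing Implicit Defensive.

(** * Monotone subsequences and Knuth moves *)

Lemma subseq_catP (T : eqType) (u a b : seq T) : subseq u (a ++ b) ->
  exists u1 u2, [/\ u = u1 ++ u2, subseq u1 a & subseq u2 b].
Proof.
case/subseqP=> m; rewrite size_cat => sz_m ->.
exists (mask (take (size a) m) a), (mask (drop (size a) m) b).
rewrite !mask_subseq -mask_cat ?cat_take_drop //.
by rewrite size_takel // sz_m leq_addr.
Qed.

Lemma subseq_mapP (T S : eqType) (f : T -> S) u w : subseq u (map f w) ->
  exists2 v, subseq v w & u = map f v.
Proof.
case/subseqP=> m _ ->; exists (mask m w); first exact: mask_subseq.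
by rewrite map_mask.
Qed.

Definition chain_rel (up : bool) : rel nat :=
  fun x y => if up then x < y else y < x.

Definition has_chain up (I : pred nat) m (w : seq nat) : Prop :=
  exists u, [/\ subseq u w, pairwise (chain_rel up) u, all I u & size u = m].

Definition convex (I : pred nat) : Prop :=
  forall x y z, x < y < z -> I x -> I z -> I y.

(** The interval I is what makes this a congruence: a chain through a ++ w ++ b
    restricts to a chain of w whose values are confined between those of its
    pieces in a and b, which is again an interval condition. *)
Definition chain_equiv (w w' : seq nat) : Prop :=
  forall up I m, convex I -> has_chain up I m w <-> has_chain up I m w'.

Lemma chain_rel_trans up : transitive (chain_rel up).
Proof. by case: up => x y z /=; lia. Qed.

Lemma chain_equiv_sym w w' : chain_equiv w w' -> chain_equiv w' w.
Proof. by move=> E up I m cI; split=> /(E up I m cI). Qed.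

Lemma chain_equiv_trans w2 w1 w3 :
  chain_equiv w1 w2 -> chain_equiv w2 w3 -> chain_equiv w1 w3.
Proof.
move=> E F up I m cI; split; first by move/(E up I m cI)/(F up I m cI).
by move/(F up I m cI)/(E up I m cI).
Qed.

(** Compatibility with the parts of a chain that precede and follow a given
    block confines the values of the block to an interval. *)
Lemma convex_between up (u1 u2 : seq nat) I : convex I ->
  convex (fun x => [&& I x, all (chain_rel up ^~ x) u1
                          & all (chain_rel up x) u2]).
Proof.
move=> cI x y z /andP[xy yz] /and3P[Ix x1 x2] /and3P[Iz z1 z2].
apply/and3P; split; first by apply: cI Ix Iz; rewrite xy.
  apply/allP=> a /[dup] /(allP x1) + /(allP z1); case: up {x1 x2 z1 z2} => /=; lia.
apply/allP=> a /[dup] /(allP x2) + /(allP z2); case: up {x1 x2 z1 z2} => /=; lia.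
Qed.

(** A chain of a ++ w ++ b is cut into three; its middle part is exchanged for a
    chain of w' that satisfies the interval condition of [convex_between]. *)
Lemma chain_equiv_cat a b w w' :
  chain_equiv w w' -> chain_equiv (a ++ w ++ b) (a ++ w' ++ b).
Proof.
have half v v' : chain_equiv v v' -> forall up I m, convex I ->
    has_chain up I m (a ++ v ++ b) -> has_chain up I m (a ++ v' ++ b).
  move=> E up I m cI [u [/subseq_catP[u1 [u' [-> s1]]]]].
  case/subseq_catP=> c [u2 [-> sc s2]].
  rewrite !pairwise_cat !all_cat allrel_catr => /and3P[/andP[r1c r12] p1].
  case/and3P=> rc2 pc p2 /and3P[I1 Ic I2] szu.
  have hc : has_chain up
      (fun x => [&& I x, all (chain_rel up ^~ x) u1 & all (chain_rel up x) u2])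
      (size c) v.
    exists c; split=> //; apply/allP=> x xc; apply/and3P; split.
    - exact: (allP Ic).
    - by apply/allP=> y y1; exact: (allrelP r1c).
    - by apply/allP=> y y2; exact: (allrelP rc2).
  have := proj1 (E up _ _ (convex_between cI)) hc.
  case=> c' [sc' pc' /allP bc' szc']; exists (u1 ++ c' ++ u2); split.
  - by rewrite !cat_subseq.
  - rewrite !pairwise_cat allrel_catr r12 p1 pc' p2 !andbT /=.
    apply/andP; split; apply/allrelP=> x y hx hy.
      by case/and3P: (bc' _ hy) => _ /allP/(_ _ hx).
    by case/and3P: (bc' _ hx) => _ _ /allP/(_ _ hy).
  - rewrite !all_cat I1 I2 andbT /=; apply/allP=> x /bc'.
    by case/and3P.
  - by rewrite -szu !size_cat szc'.
move=> E up I m cI; split; first exact: half.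
by apply: half => //; apply: chain_equiv_sym.
Qed.

Lemma chain_equiv_cons a w w' :
  chain_equiv w w' -> chain_equiv (a :: w) (a :: w').
Proof. by move/(chain_equiv_cat [:: a] [::]); rewrite !cats0. Qed.

(** The two triples of a Knuth move contain the same chains but for one pair:
    x, z is increasing in one of them, z, x is decreasing in the other. One
    letter of the pair is then traded for y, whose value lies in every interval
    containing x and z. The tactics search the subsequences of a triple, given
    as masks. *)
Ltac knuth_witness mk :=
  match goal with |- has_chain _ _ _ ?w =>
    exists (mask mk w); split; [exact: mask_subseq | rewrite /=; lia ..]
  end.

Ltac knuth_cases :=
  let xy := fresh "xy" in let yz := fresh "yz" in let Iy := fresh "Iy" in
  let mk := fresh "mk" in let up := fresh "up" in let cI := fresh "cI" in
  move=> /andP[xy yz] up I ? cI; have Iy := cI _ _ _ (introT andP (conj xy yz));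
  split=> -[? [/subseqP[mk + ->] + + <-]];
  case: mk => [|[] [|[] [|[] [|? ?]]]] //= _;
  case: up => /= *;
  first [ lia
        | knuth_witness [:: false; false; false]
        | knuth_witness [:: true; false; false]
        | knuth_witness [:: false; true; false]
        | knuth_witness [:: false; false; true]
        | knuth_witness [:: true; true; false]
        | knuth_witness [:: true; false; true]
        | knuth_witness [:: false; true; true] ].

Lemma knuth_move_xzy x y z :
  x < y < z -> chain_equiv [:: x; z; y] [:: z; x; y].
Proof. knuth_cases. Qed.

Lemma knuth_move_yxz x y z :
  x < y < z -> chain_equiv [:: y; x; z] [:: y; z; x].
Proof. knuth_cases. Qed.

(** The inserted letter x travels left through the larger letters that follow
    the bumped letter y. *)
Lemma chain_equiv_bump_suffix x y s : x < y -> path ltn y s ->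
  chain_equiv (y :: rcons s x) (y :: x :: s).
Proof.
elim: s y => [|z s IHs] y xy //= /andP[yz zs].
apply: (@chain_equiv_trans (y :: z :: x :: s)).
  by apply: chain_equiv_cons; apply: IHs zs; apply: ltn_trans yz.
apply: (@chain_equiv_cat [::] s [:: y; z; x] [:: y; x; z]).
by apply/chain_equiv_sym/knuth_move_yxz; rewrite xy.
Qed.

(** The bumped letter y travels left through the letters smaller than x. *)
Lemma chain_equiv_bump_prefix x y s t : sorted ltn (rcons s x) -> x < y ->
  chain_equiv (s ++ y :: x :: t) (y :: s ++ x :: t).
Proof.
move=> + xy; elim: s => [|p s IHs] //= /[dup] pth.
move/path_sorted/IHs=> {}IHs.
apply: chain_equiv_trans (chain_equiv_cons p IHs) _.
(* the entry following p is still smaller than y *)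
have [q [u [-> pq qy]]] : exists q u, [/\ s ++ x :: t = q :: u, p < q & q < y].
  case: s pth {IHs} => [|q s] /=; first by rewrite andbT; exists x, t.
  case/andP=> pq; rewrite (path_sortedE ltn_trans) all_rcons.
  by case/andP=> /andP[qx _] _; exists q, (s ++ x :: t); rewrite (ltn_trans qx).
apply: (@chain_equiv_cat [::] u [:: p; y; q] [:: y; p; q]).
by apply: knuth_move_xzy; rewrite pq.
Qed.

(** One row of the insertion algorithm: x bumps y out of the row s ++ y :: t,
    and y, which goes to the next row, precedes the new row in reading order. *)
Lemma chain_equiv_bump x y s t :
  sorted ltn (rcons s x) -> x < y -> path ltn y t ->
  chain_equiv (rcons (s ++ y :: t) x) (y :: s ++ x :: t).
Proof.
move=> sx xy yt; rewrite rcons_cat.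
apply: chain_equiv_trans (chain_equiv_bump_prefix t sx xy).
have := chain_equiv_cat s [::] (chain_equiv_bump_suffix xy yt).
by rewrite !cats0.
Qed.

(** * Row insertion *)

(** Rows are read from bottom to top, each one from left to right. *)
Definition reading (T : tableau) : seq nat := flatten (rev T).

Definition dominates (r r' : seq nat) : Prop :=
  forall j, j < size r' -> j < size r /\ nth 0 r j < nth 0 r' j.

(** Nonempty increasing rows, each one dominated by the next: a Young tableau.
    The entries need not be 1, ..., n, so that the notion holds at every stage
    of the insertion of a permutation. *)
Fixpoint is_tableau (T : tableau) : Prop :=
  if T is r :: T' then
    [/\ 0 < size r, sorted ltn r, dominates r (head [::] T') & is_tableau T']
  else True.

Lemma reading_cons r T : reading (r :: T) = reading T ++ r.
Proof. by rewrite /reading rev_cons flatten_rcons. Qed.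

(** Row insertion is computed with [find] and [set_nth], while Knuth moves act
    on factors of a word; this translates the indices into factors. *)
Variant row_position x (r : seq nat) : Prop :=
| RowAppend of sorted ltn (rcons r x) & find (ltn x) r = size r
| RowBump s y t of r = s ++ y :: t & sorted ltn (rcons s x) & x < y
    & path ltn y t & find (ltn x) r = size s.

Lemma row_positionP x r : sorted ltn r -> x \notin r -> row_position x r.
Proof.
elim: r => [|a r IHr] //= => [_ _|ar]; first exact: RowAppend.
rewrite inE negb_or => /andP[xa xr]; case: (ltnP x a) => [lt_xa | le_ax].
  by apply: (@RowBump _ _ [::] a r); rewrite //= lt_xa.
have lt_ax : a < x by rewrite ltn_neqAle eq_sym xa.
case: (IHr (path_sorted ar) xr) => [srt fnd | s y t def_r srt xy yt fnd].
  apply: RowAppend; rewrite /= ?ltnNge ?le_ax /= ?fnd //.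
  by case: r ar srt {IHr xr fnd} => [|b r] /= => [_ _|/andP[-> _] //]; rewrite lt_ax.
apply: (@RowBump _ _ (a :: s) y t); rewrite /= ?def_r -?def_r //; last first.
  by rewrite ltnNge le_ax fnd.
move: ar srt; rewrite def_r; case: s {def_r fnd} => [|b s] /=.
  by rewrite lt_ax.
by case/andP=> ->.
Qed.

(** The entry bumped from column j of r lands in the next row at a column
    j' <= j, because the entry of h in column j, if any, exceeds it, and the
    new row r has a smaller entry in every column up to j. *)
Lemma dominates_bump r h j x : sorted ltn r -> dominates r h ->
  j < size r -> x < nth 0 r j ->
  dominates (set_nth 0 r j x)
    (set_nth 0 h (find (ltn (nth 0 r j)) h) (nth 0 r j)).
Proof.
move=> srt dom jr; set y := nth 0 r j => xy; set j' := find _ h.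
have j'j : j' <= j.
  case: (ltnP j (size h)) => jh; last by apply: leq_trans (find_size _ _) jh.
  rewrite leqNgt; apply/negP=> /(before_find 0) /=.
  by have [_ ->] := dom _ jh.
move=> i; rewrite !size_set_nth leq_max => ih.
rewrite !nth_set_nth /=; split.
  case/orP: ih => [|/dom[]]; lia.
case: (ltngtP i j') => [ij'|ij'|->].
- have ih' : i < size h by apply: leq_trans ij' (find_size _ _).
  by rewrite ltn_eqF ?(leq_trans ij') //; have [] := dom _ ih'.
- have ih' : i < size h by lia.
  have [ir ri] := dom _ ih'.
  by case: (i =P j) ri => // -> ; apply: ltn_trans.
- have [//|nj] := j' =P j.
  apply: (sorted_ltn_nth ltn_trans) => //; rewrite ?inE; lia.
Qed.

(** An empty tableau behaves as a tableau whose first row is empty, which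
    removes the case distinction in the comparison of consecutive rows. *)
Lemma head_row_insert x T : head [::] (row_insert x T).1 =
  set_nth 0 (head [::] T) (find (ltn x) (head [::] T)) x.
Proof. by case: T => [|r T] //=; case: ifP => // _; case: row_insert. Qed.

Lemma shape_row_insert x T :
  map size (row_insert x T).1 = incr_nth (map size T) (row_insert x T).2.
Proof.
elim: T x => [|r T IHT] x //=.
case: ifP => [lt_r | /negbT]; last first.
  rewrite -leqNgt => /(conj (find_size (ltn x) r))/andP/anti_leq ->.
  by rewrite /= size_set_nth (maxn_idPl _).
have := IHT (nth 0 r (find (ltn x) r)); case: row_insert => T' i /= ->.
by rewrite size_set_nth (maxn_idPr _).
Qed.

(** The equivalence holds row by row: the letter bumped out of a row is
    inserted into the rows below, whose reading comes first. *)
Lemma row_insertP x T : is_tableau T -> uniq (x :: reading T) ->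
  let T' := (row_insert x T).1 in
  [/\ is_tableau T', perm_eq (reading T') (x :: reading T)
    & chain_equiv (rcons (reading T) x) (reading T')].
Proof.
elim: T x => [|r T IHT] x /=; first by move=> _ _; split.
case=> r_gt0 srt dom tabT; rewrite reading_cons.
rewrite mem_cat negb_or cat_uniq => /andP[/andP[xT xr] /and3P[uT /hasPn dis ur]].
case: (row_positionP srt xr) => [srt' fnd | s y t def_r srt' xy yt fnd]; rewrite fnd.
  rewrite ltnn /= set_nthE ltnn subnn /= cats1 !reading_cons; split.
  - split=> //; first by rewrite size_rcons.
    by move=> j /dom[jr rj]; rewrite size_rcons nth_rcons jr ltnS ltnW.
  - by rewrite -rcons_cat perm_rcons.
  - by rewrite rcons_cat.
have sr : size s < size r by rewrite def_r size_cat /= -addSnnS leq_addr.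
have nth_r : nth 0 r (size s) = y by rewrite def_r nth_cat ltnn subnn.
have set_r : set_nth 0 r (size s) x = s ++ x :: t.
  rewrite set_nthE sr def_r take_size_cat // drop_cat ltnNge leqnSn /=.
  by rewrite subSnn /= drop0.
have yT : y \notin reading T.
  by apply: dis; rewrite def_r mem_cat mem_head orbT.
rewrite sr nth_r; have := IHT y tabT; rewrite /= yT uT => /(_ isT).
have := dominates_bump srt dom sr; rewrite nth_r => /(_ x xy).
rewrite -head_row_insert.
case: row_insert => T' i /= dom' [tabT' permT' equivT'].
rewrite set_r in dom' *; rewrite !reading_cons; split.
- split=> //; first by rewrite size_cat addnS.
  rewrite sorted_cat_cons srt' /=; case: t yt {def_r set_r dom'} => //= z t.
  by case/andP=> /(ltn_trans xy) -> ->.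
- apply/seq.permP => p; rewrite !count_cat /= def_r !count_cat /=.
  rewrite (seq.permP permT') /=.
  by move: (count p) (nat_of_bool (p x)) (nat_of_bool (p y)) => c a b; lia.
- have := chain_equiv_cat (reading T) [::] (chain_equiv_bump srt' xy yt).
  rewrite !cats0 -rcons_cat -def_r => /chain_equiv_trans; apply.
  have := chain_equiv_cat [::] (s ++ x :: t) equivT'.
  by rewrite /= cat_rcons.
Qed.

Lemma shape_append_cell Q i m :
  map size (append_cell Q i m) = incr_nth (map size Q) i.
Proof.
apply: (@eq_from_nth _ 0) => [|j _].
  by rewrite size_incr_nth !size_map size_set_nth; case: ltnP => h; lia.
have nth_size T : nth 0 (map size T) j = size (nth [::] T j :> seq nat).
  by case: (ltnP j (size T)) => h; [rewrite (nth_map [::]) | rewrite !nth_default ?size_map].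
rewrite nth_incr_nth !nth_size nth_set_nth /= eq_sym.
by case: eqP => [-> | _]; rewrite ?size_rcons.
Qed.

Lemma rsk_fold_spec w ms P Q : is_tableau P -> uniq (reading P ++ w) ->
  map size P = map size Q -> size w = size ms ->
  let PQ := foldl rsk_step (P, Q) (zip w ms) in
  [/\ is_tableau PQ.1, perm_eq (reading PQ.1) (reading P ++ w),
     chain_equiv (reading P ++ w) (reading PQ.1)
   & map size PQ.1 = map size PQ.2].
Proof.
elim: w ms P Q => [|x w IHw] [|m ms] //= P Q tabP uPw shapePQ.
  by move=> _; rewrite cats0; split.
case=> szw.
have uxP : uniq (x :: reading P).
  by move: uPw; rewrite -cat_rcons cat_uniq rcons_uniq; case/and3P.
have [] := row_insertP tabP uxP; have := shape_row_insert x P.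
have -> : rsk_step (P, Q) (x, m) = let: (P', i) := row_insert x P in
  (P', append_cell Q i m) by [].
case: row_insert => P' i /= shapeP' tabP' permP' equivP'.
have permw : perm_eq (reading P' ++ w) (reading P ++ x :: w).
  by rewrite -cat_rcons perm_cat2r (permPl permP') perm_sym perm_rcons.
case: (IHw ms P' (append_cell Q i m)) => //.
- by rewrite (perm_uniq permw).
- by rewrite shapeP' shape_append_cell shapePQ.
move=> tab perm equiv shape; split=> //; first exact: perm_trans permw.
apply: chain_equiv_trans equiv.
by have := chain_equiv_cat [::] w equivP'; rewrite /= cat_rcons.
Qed.

Lemma cols_dominate T i j : is_tableau T -> j < size (nth [::] T i.+1) ->
  j < size (nth [::] T i) /\ nth 0 (nth [::] T i) j < nth 0 (nth [::] T i.+1) j.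
Proof.
elim: T i => [|r T IHT] [|i] //=; last by case=> _ _ _; apply: IHT.
by case=> _ _ dom _; rewrite nth0; apply: dom.
Qed.

Lemma rows_sorted T i : is_tableau T -> sorted ltn (nth [::] T i).
Proof. by elim: T i => [|r T IHT] [|i] //= [_ srt _ /IHT]. Qed.

Lemma rows_nonempty T i : is_tableau T -> i < size T -> 0 < size (nth [::] T i).
Proof. by elim: T i => [|r T IHT] [|i] //= [r0 _ _ /IHT]; [|apply]. Qed.

(** Unlike in [entry], the rows and columns of a cell c = (i, j) are numbered
    from 0. *)
Definition cell_entry (T : tableau) (c : nat * nat) : nat :=
  nth 0 (nth [::] T c.1) c.2.

Definition in_shape (T : tableau) : pred (nat * nat) :=
  fun c => c.2 < size (nth [::] T c.1).

(** * Cells in reading order *)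

Lemma row_increasing T i j j' : is_tableau T -> in_shape T (i, j') ->
  j < j' -> cell_entry T (i, j) < cell_entry T (i, j').
Proof.
move=> tabT inT jj'; apply: (sorted_ltn_nth ltn_trans) => //; first exact: rows_sorted.
exact: ltn_trans inT.
Qed.

Lemma southeast T i j i' j' : is_tableau T -> in_shape T (i', j') ->
  i <= i' -> j <= j' ->
  in_shape T (i, j) /\ cell_entry T (i, j) <= cell_entry T (i', j').
Proof.
move=> tabT inT ii' jj'.
have {inT jj'} [inT le_row] :
    in_shape T (i', j) /\ cell_entry T (i', j) <= cell_entry T (i', j').
  move: jj'; rewrite leq_eqVlt => /predU1P[->|lt_j]; first by split.
  split; first exact: ltn_trans inT.
  by apply: ltnW; apply: row_increasing.
suff [? le_col] : in_shape T (i, j) /\ cell_entry T (i, j) <= cell_entry T (i', j).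
  by split=> //; apply: leq_trans le_row.
elim: i' ii' inT {le_row} => [|i' IH]; first by rewrite leqn0 => /eqP->.
rewrite leq_eqVlt ltnS => /predU1P[->|le_i] // inT.
have [inT' lt_col] := cols_dominate tabT inT.
by have [? le_col] := IH le_i inT'; split=> //; apply: leq_trans (ltnW lt_col).
Qed.

(** The cells themselves, in the order of the reading word, so that a
    subsequence of the reading word becomes a list of cells. *)
Fixpoint reading_cells (T : tableau) : seq (nat * nat) :=
  if T is r :: T' then
    [seq (c.1.+1, c.2) | c <- reading_cells T'] ++
    [seq (0, j) | j <- iota 0 (size r)]
  else [::].

Definition before : rel (nat * nat) :=
  fun c d => (d.1 < c.1) || (c.1 == d.1) && (c.2 < d.2).

Lemma before_trans : transitive before.
Proof. by move=> [a b] [c d] [e f]; rewrite /before /=; lia. Qed.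

Lemma before_irr : irreflexive before.
Proof. by move=> [a b]; rewrite /before /=; lia. Qed.

Lemma reading_cellsE T : map (cell_entry T) (reading_cells T) = reading T.
Proof.
elim: T => [|r T IHT] //=; rewrite reading_cons map_cat -!map_comp; congr cat.
  by rewrite -IHT; apply: eq_map => -[].
exact: (mkseq_nth 0 r).
Qed.

Lemma mem_reading_cells T : reading_cells T =i in_shape T.
Proof.
move=> c; rewrite -[RHS]/(in_shape T c).
elim: T c => [|r T IHT] [i j] /=; first by rewrite /in_shape /= nth_nil.
rewrite mem_cat; apply/orP/idP => [[] /mapP[]|].
- by move=> c; rewrite IHT => inT [-> ->].
- by move=> j'; rewrite mem_iota => lt_j' [-> ->].
case: i => [|i] inT; first by right; apply: map_f; rewrite mem_iota.
by left; apply/mapP; exists (i, j); rewrite ?IHT.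
Qed.

Lemma pairwise_iota (r : rel nat) n :
  (forall a b, a < b < n -> r a b) -> pairwise r (iota 0 n).
Proof.
move=> r_lt; have: pairwise ltn (iota 0 n).
  by rewrite -(sorted_pairwise ltn_trans) iota_ltn_sorted.
apply: (sub_in_pairwise (P := gtn n)); last by apply/allP=> x; rewrite mem_iota.
by move=> a b _ bn ab; apply: r_lt; apply/andP.
Qed.

Lemma reading_cells_before T : pairwise before (reading_cells T).
Proof.
elim: T => [|r T IHT] //=; rewrite pairwise_cat !pairwise_map; apply/and3P; split.
- by apply/allrelP=> _ _ /mapP[c _ ->] /mapP[j _ ->].
- by congr is_true: IHT; apply: eq_pairwise => c d; rewrite /before /= ltnS eqSS.
- by apply: pairwise_iota => a b /andP[ab _]; rewrite /before /= ab.
Qed.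

(** Since [before] is a strict order, any list of cells that increases for it
    is a sublist of the list of all cells. *)
Lemma has_chain_reading up I m T :
  has_chain up I m (reading T) <->
  exists cs, [/\ pairwise before cs, all (in_shape T) cs,
    pairwise (fun c d => chain_rel up (cell_entry T c) (cell_entry T d)) cs,
    all (fun c => I (cell_entry T c)) cs & size cs = m].
Proof.
rewrite -reading_cellsE; split=> [[_ [/subseq_mapP[cs sub ->]]] | [cs [bef inT ch Ics szcs]]].
  rewrite pairwise_map all_map size_map => ch Ics szcs; exists cs; split=> //.
    exact: subseq_pairwise sub (reading_cells_before T).
  by apply/allP=> c /(mem_subseq sub); rewrite mem_reading_cells.
exists (map (cell_entry T) cs); rewrite pairwise_map all_map size_map; split=> //.
apply: map_subseq.
suff -> : cs = filter [in cs] (reading_cells T) by apply: filter_subseq.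
apply: (irr_sorted_eq before_trans before_irr).
- exact: pairwise_sorted.
- by apply/pairwise_sorted/pairwise_filter/reading_cells_before.
- move=> c; rewrite mem_filter mem_reading_cells /=.
  by case: (boolP (c \in cs)) => // /(allP inT).
Qed.

Lemma sorted_ltn_bounded n s : sorted ltn s -> all (gtn n) s ->
  size s <= n /\ (size s = n -> s = iota 0 n).
Proof.
move=> srt /allP lt_n.
have us : uniq s by apply: sorted_uniq srt; [exact: ltn_trans | exact: ltnn].
have sub : {subset s <= iota 0 n} by move=> x /lt_n; rewrite mem_iota.
split; first by have := uniq_leq_size us sub; rewrite size_iota.
move=> szs; apply: (irr_sorted_eq ltn_trans ltnn srt (iota_ltn_sorted 0 n)).
by have [] := uniq_min_size us sub; rewrite ?size_iota ?szs.
Qed.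

(** A cell read later lies in the same row or higher. If it were not further
    to the right, it would be weakly northwest of c and its entry at most that
    of c. *)
Lemma before_incr_col T c d : is_tableau T -> in_shape T c -> before c d ->
  cell_entry T c < cell_entry T d -> c.2 < d.2.
Proof.
case: c d => [i j] [i' j'] tabT inT; rewrite /before /= => bef.
apply: contraLR; rewrite -!leqNgt => le_j; case/orP: bef => [lt_i|]; last lia.
by have [] := southeast tabT inT (ltnW lt_i) le_j.
Qed.

Lemma before_decr_row T c d : is_tableau T -> in_shape T d -> before c d ->
  cell_entry T d < cell_entry T c -> d.1 < c.1.
Proof.
case: c d => [i j] [i' j'] tabT inT; rewrite /before /=.
case/orP=> [-> //|/andP[/eqP-> lt_j]].
by rewrite ltnNge ltnW ?row_increasing.
Qed.

(** * Chains of maximal length meet every row or every column *)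

Lemma in_shape_row T c : in_shape T c -> c.1 < num_rows T.
Proof.
rewrite /in_shape => c_in; rewrite ltnNge.
by apply: contraL c_in => le_c; rewrite nth_default.
Qed.

(** A decreasing chain climbs from the bottom, so that its row indices increase
    once the chain is reversed. *)
Lemma decreasing_chain_rows T cs : is_tableau T ->
  pairwise before cs -> all (in_shape T) cs ->
  pairwise (fun c d => chain_rel false (cell_entry T c) (cell_entry T d)) cs ->
  sorted ltn (rev (map fst cs)) /\ all (gtn (size T)) (rev (map fst cs)).
Proof.
move=> tabT bef /allP inT ch; rewrite rev_sorted all_rev all_map; split.
  rewrite sorted_pairwise ?pairwise_map; last by move=> a b c /=; lia.
  have := conj bef ch => /andP; rewrite -pairwise_relI.
  apply: (sub_in_pairwise (P := in_shape T)); last exact/allP.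
  by move=> c d _ dT /andP[bcd lt_dc]; apply: before_decr_row dT bcd lt_dc.
by apply/allP=> c /inT/in_shape_row.
Qed.

Lemma increasing_chain_cols T cs : is_tableau T ->
  pairwise before cs -> all (in_shape T) cs ->
  pairwise (fun c d => chain_rel true (cell_entry T c) (cell_entry T d)) cs ->
  sorted ltn (map snd cs) /\ all (gtn (num_cols T)) (map snd cs).
Proof.
move=> tabT bef /allP inT ch; rewrite all_map; split.
  rewrite sorted_pairwise ?pairwise_map; last exact: ltn_trans.
  have := conj bef ch => /andP; rewrite -pairwise_relI.
  apply: (sub_in_pairwise (P := in_shape T)); last exact/allP.
  by move=> c d cT _ /andP[bcd lt_cd]; apply: before_incr_col cT bcd lt_cd.
apply/allP=> -[i j] /inT inTij /=; rewrite /num_cols -nth0.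
by have [] := southeast tabT inTij (leq0n i) (leqnn j).
Qed.

Lemma chain_le_rows T I m : is_tableau T ->
  has_chain false I m (reading T) -> m <= num_rows T.
Proof.
move=> tabT /has_chain_reading[cs [bef inT ch _ <-]].
have [srt bd] := decreasing_chain_rows tabT bef inT ch.
by have [] := sorted_ltn_bounded srt bd; rewrite size_rev size_map.
Qed.

Lemma chain_le_cols T I m : is_tableau T ->
  has_chain true I m (reading T) -> m <= num_cols T.
Proof.
move=> tabT /has_chain_reading[cs [bef inT ch _ <-]].
have [srt bd] := increasing_chain_cols tabT bef inT ch.
by have [] := sorted_ltn_bounded srt bd; rewrite size_map.
Qed.

Lemma pairwise_nth (r : rel (nat * nat)) cs a b x0 : pairwise r cs ->
  a < b < size cs -> r (nth x0 cs a) (nth x0 cs b).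
Proof.
move=> /(pairwiseP x0) pw /andP[ab bs]; apply: pw => //.
exact: ltn_trans bs.
Qed.

Lemma stepwise_increasing (f : nat -> nat) n :
  (forall i, i.+1 < n -> f i < f i.+1) -> forall a b, a < b < n -> f a < f b.
Proof.
move=> step a; elim=> [|b IHb] // /andP[]; rewrite ltnS leq_eqVlt.
case/predU1P=> [-> | lt_ab] lt_b; first exact: step.
by apply: ltn_trans (step b lt_b); apply: IHb; rewrite lt_ab ltnW.
Qed.

Definition row_transversal T (I : pred nat) (j : nat -> nat) : Prop :=
  (forall i, i < num_rows T -> in_shape T (i, j i) /\ I (cell_entry T (i, j i)))
  /\ forall i, i.+1 < num_rows T ->
       cell_entry T (i, j i) < cell_entry T (i.+1, j i.+1).

Definition col_transversal T (I : pred nat) (i : nat -> nat) : Prop :=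
  (forall j, j < num_cols T -> in_shape T (i j, j) /\ I (cell_entry T (i j, j)))
  /\ forall j, j.+1 < num_cols T ->
       cell_entry T (i j, j) < cell_entry T (i j.+1, j.+1).

(** A chain with as many cells as there are rows visits rows r - 1, ..., 0 in
    this order, so it is given by a column index for each row. Conversely, the
    entries of a row transversal decrease in reading order, whatever the
    columns are. *)
Lemma full_decreasing_chainP T I : is_tableau T ->
  has_chain false I (num_rows T) (reading T) <->
  exists j, row_transversal T I j.
Proof.
move=> tabT; rewrite has_chain_reading; split.
  case=> cs [bef inT ch Ics szcs].
  have [srt bd] := decreasing_chain_rows tabT bef inT ch.
  have [_] := sorted_ltn_bounded srt bd.
  rewrite size_rev size_map => /(_ szcs) rowsE.
  pose c i := nth (0, 0) (rev cs) i.
  have c1 i : i < num_rows T -> (c i).1 = i.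
    move=> lt_i; rewrite -(nth_map _ 0 fst) ?size_rev ?szcs //.
    by rewrite map_rev rowsE nth_iota.
  have cE i : i < num_rows T -> c i = (i, (c i).2).
    by move=> lt_i; rewrite [LHS]surjective_pairing c1.
  have c_in i : i < num_rows T -> c i \in cs.
    by move=> lt_i; rewrite -mem_rev mem_nth // size_rev szcs.
  exists (fun i => (c i).2); split=> i lt_i.
    by rewrite -cE //; split; [apply: (allP inT) | apply: (allP Ics)]; apply: c_in.
  rewrite -!cE //; last exact: ltnW.
  rewrite /c !nth_rev ?szcs //; last exact: ltnW.
  by apply: (pairwise_nth (0, 0) ch); rewrite szcs; lia.
case=> j [in_j inc_j]; pose c i := (num_rows T - i.+1, j (num_rows T - i.+1)).
have lt_c i : i \in iota 0 (num_rows T) -> num_rows T - i.+1 < num_rows T.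
  by rewrite mem_iota; lia.
exists (map c (iota 0 (num_rows T))).
rewrite !all_map !pairwise_map size_map size_iota; split=> //.
- by apply: pairwise_iota => a b ab; rewrite /before /=; apply/orP; left; lia.
- by apply/allP=> i /lt_c/in_j[].
- by apply: pairwise_iota => a b ab /=; apply: (stepwise_increasing inc_j); lia.
- by apply/allP=> i /lt_c/in_j[].
Qed.

Fixpoint prefix_min (f : nat -> nat) n :=
  if n is n'.+1 then minn (prefix_min f n') (f n) else f 0.

Lemma prefix_min_le f n : prefix_min f n <= f n.
Proof. by case: n => //= n; apply: geq_minr. Qed.

(** An increasing sequence with one entry in each column may go down at some
    steps, and then it is not a subsequence of the reading word. Replacing each
    row index by the minimum of the row indices up to that column cures this:
    the entries can only get smaller, and they still increase. *)
Lemma full_increasing_chainP T I : is_tableau T -> convex I ->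
  has_chain true I (num_cols T) (reading T) <->
  exists i, col_transversal T I i.
Proof.
move=> tabT cI; rewrite has_chain_reading; split.
  case=> cs [bef inT ch Ics szcs].
  have [srt bd] := increasing_chain_cols tabT bef inT ch.
  have [_] := sorted_ltn_bounded srt bd.
  rewrite size_map => /(_ szcs) colsE.
  pose c i := nth (0, 0) cs i.
  have cE j : j < num_cols T -> c j = ((c j).1, j).
    move=> lt_j; rewrite [LHS]surjective_pairing; congr pair.
    by rewrite -(nth_map _ 0 snd) ?szcs // colsE nth_iota.
  have c_in j : j < num_cols T -> c j \in cs.
    by move=> lt_j; rewrite mem_nth // szcs.
  exists (fun j => (c j).1); split=> j lt_j.
    by rewrite -cE //; split; [apply: (allP inT) | apply: (allP Ics)]; apply: c_in.
  rewrite -!cE //; last exact: ltnW.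
  by apply: (pairwise_nth (0, 0) ch); rewrite szcs; lia.
case=> i [in_i inc_i]; pose m := prefix_min i.
have in_m j : j < num_cols T -> in_shape T (m j, j) /\
    cell_entry T (m j, j) <= cell_entry T (i j, j).
  by case/in_i=> inT _; apply: southeast inT _ _ => //; apply: prefix_min_le.
have inc_m j : j.+1 < num_cols T ->
    cell_entry T (m j, j) < cell_entry T (m j.+1, j.+1).
  move=> lt_j; have [inT le_e] := in_m _ lt_j; move: inT.
  have -> : m j.+1 = minn (m j) (i j.+1) by [].
  (* either the row is kept, or it moves up to the row that i chose *)
  case: (leqP (m j) (i j.+1)) => _ inT; first exact: row_increasing inT (ltnSn j).
  by apply: leq_ltn_trans (inc_i j lt_j); case: (in_m j (ltnW lt_j)).
have Im j : j < num_cols T -> I (cell_entry T (m j, j)).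
  move=> lt_j; case: (posnP j) => [j0 | j_gt0]; first by subst j; case: (in_i 0).
  have [_ le_e] := in_m _ lt_j; have [_ Ij] := in_i _ lt_j.
  move: le_e; rewrite leq_eqVlt => /predU1P[-> //|lt_e].
  have [_ I0] := in_i 0 (leq_ltn_trans (leq0n j) lt_j).
  apply: cI I0 Ij; rewrite lt_e andbT -[i 0]/(m 0).
  by apply: (stepwise_increasing inc_m); rewrite j_gt0.
have m_anti a b : a <= b -> m b <= m a.
  elim: b => [|b IHb]; first by rewrite leqn0 => /eqP->.
  rewrite leq_eqVlt => /predU1P[-> //|/IHb]; apply: leq_trans.
  exact: geq_minl.
exists [seq (m j, j) | j <- iota 0 (num_cols T)].
rewrite !all_map !pairwise_map size_map size_iota; split=> //.
- apply: pairwise_iota => a b /andP[ab _]; rewrite /before /=.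
  by have := m_anti a b (ltnW ab); lia.
- by apply/allP=> j; rewrite mem_iota => /in_m[].
- by apply: pairwise_iota => a b ab /=; apply: (stepwise_increasing inc_m).
- by apply/allP=> j; rewrite mem_iota => /Im.
Qed.

(** The last cell of a transversal of the columns lies in the last column,
    where the smallest entry is the one of the first row. *)
Lemma first_rowP T t : is_tableau T -> 0 < num_cols T ->
  has_chain true (gtn t) (num_cols T) (reading T) <->
  cell_entry T (0, (num_cols T).-1) < t.
Proof.
move=> tabT C_gt0; rewrite full_increasing_chainP //; last first.
  by move=> x y z /= /andP[_ yz] _; apply: ltn_trans.
have in_top j : j < num_cols T -> in_shape T (0, j) by rewrite /num_cols -nth0.
split=> [[i [in_i _]] | lt_t].
  have lt_C : (num_cols T).-1 < num_cols T by rewrite prednK.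
  have [inT /=] := in_i _ lt_C; apply: leq_ltn_trans.
  by have [] := southeast tabT inT (leq0n _) (leqnn _).
exists (fun=> 0); split=> j lt_j; last exact: row_increasing (in_top _ lt_j) _.
split; first exact: in_top.
apply: leq_ltn_trans lt_t.
have inT : in_shape T (0, (num_cols T).-1) by apply: in_top; rewrite prednK.
have le_j : j <= (num_cols T).-1 by rewrite -ltnS prednK.
by have [] := southeast tabT inT (leqnn 0) le_j.
Qed.

(** The cell of a transversal of the rows that lies in the last row has an
    entry at least that of the first column, and all other entries of the
    first column are smaller. *)
Lemma first_colP T t : is_tableau T -> 0 < num_rows T ->
  has_chain false (gtn t) (num_rows T) (reading T) <->
  cell_entry T ((num_rows T).-1, 0) < t.
Proof.
move=> tabT R_gt0; rewrite full_decreasing_chainP //.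
have in_left i : i < num_rows T -> in_shape T (i, 0) by apply: rows_nonempty.
split=> [[j [in_j _]] | lt_t].
  have lt_R : (num_rows T).-1 < num_rows T by rewrite prednK.
  have [inT /=] := in_j _ lt_R; apply: leq_ltn_trans.
  by have [] := southeast tabT inT (leqnn _) (leq0n _).
exists (fun=> 0); split=> i lt_i; last first.
  by have [] := cols_dominate tabT (in_left _ lt_i).
split; first exact: in_left.
apply: leq_ltn_trans lt_t.
have inT : in_shape T ((num_rows T).-1, 0) by apply: in_left; rewrite prednK.
have le_i : i <= (num_rows T).-1 by rewrite -ltnS prednK.
by have [] := southeast tabT inT le_i (leqnn 0).
Qed.

(** * Chains in extensions *)

Lemma contains_incrP m n (s : 'S_n) :
  contains_incr m s <-> has_chain true predT m (one_line s).
Proof.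
split=> [[u [sub szu srt]] | [u [sub srt _ szu]]]; exists u; split=> //.
- by rewrite -(sorted_pairwise ltn_trans).
- exact: all_predT.
- by rewrite (sorted_pairwise ltn_trans).
Qed.

Lemma contains_decrP m n (s : 'S_n) :
  contains_decr m s <-> has_chain false predT m (one_line s).
Proof.
have gtn_tr : transitive gtn by move=> a b c /=; lia.
split=> [[u [sub szu srt]] | [u [sub srt _ szu]]]; exists u; split=> //.
- by rewrite -(sorted_pairwise gtn_tr).
- exact: all_predT.
- by rewrite (sorted_pairwise gtn_tr).
Qed.

Lemma has_chain_rev up I m w :
  has_chain up I m (rev w) <-> has_chain (~~ up) I m w.
Proof.
have half b v : has_chain b I m v -> has_chain (~~ b) I m (rev v).
  case=> u [sub pw Iu szu]; exists (rev u).
  rewrite subseq_rev size_rev all_rev; split=> //.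
  rewrite -sorted_pairwise ?rev_sorted; last exact: chain_rel_trans.
  move: pw; rewrite -(sorted_pairwise (@chain_rel_trans b)).
  by congr is_true; apply: eq_sorted; case: b.
split=> /half; first by rewrite revK.
by rewrite negbK.
Qed.

(** The values that a chain may take for t to be appended to it, once the
    values at least t have been increased by one. *)
Definition extendible_right up t : pred nat :=
  fun x => if up then x < t else t <= x.

Lemma has_chain_extend_right up m t w :
  has_chain up predT m.+1 (rcons (map (shift_from t) w) t) <->
  has_chain up predT m.+1 w \/ has_chain up (extendible_right up t) m w.
Proof.
have shift_rel x y :
    chain_rel up (shift_from t x) (shift_from t y) = chain_rel up x y.
  by rewrite /shift_from; case: (ltnP x t); case: (ltnP y t); case: up => /=; lia.
have shift_pw v : pairwise (chain_rel up) (map (shift_from t) v) =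
    pairwise (chain_rel up) v.
  by rewrite pairwise_map; apply: (eq_pairwise shift_rel).
have shift_t x : chain_rel up (shift_from t x) t = extendible_right up t x.
  rewrite /shift_from /extendible_right.
  by case: (ltnP x t); case: up {shift_rel shift_pw} => /=; lia.
split.
  case=> u [+ pw _ szu]; rewrite -cats1 => /subseq_catP[u1 [u2 [def_u]]].
  case/subseq_mapP=> v sub def_u1 u2_t; rewrite def_u def_u1 in pw szu.
  move: pw szu; rewrite pairwise_cat shift_pw size_cat size_map =>
    /and3P[u12 pv _].
  case: u2 u2_t u12 {def_u} => [|a u2] /=.
    by rewrite addn0 => _ _ szv; left; exists v; rewrite all_predT.
  case: (a =P t) => // -> /eqP ->; rewrite allrel1r all_map addn1 => ut [szv].
  right; exists v; split=> //; apply: sub_all ut => x.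
  by rewrite /= shift_t.
case=> [[v [sub pv _ szv]] | [v [sub pv vt szv]]].
  exists (map (shift_from t) v); split; rewrite ?all_predT ?size_map //.
    by rewrite -cats1; apply: subseq_trans (prefix_subseq _ _); apply: map_subseq.
  by rewrite shift_pw.
exists (rcons (map (shift_from t) v) t).
split; rewrite ?all_predT ?size_rcons ?size_map ?szv //.
  by rewrite -!cats1 cat_subseq ?map_subseq.
rewrite pairwise_rcons all_map shift_pw pv andbT.
by apply: sub_all vt => x; rewrite /= shift_t.
Qed.

(** Reversal of words exchanges the two sides and the two kinds of chains. *)
Lemma has_chain_extend_left up m t w :
  has_chain up predT m.+1 (t :: map (shift_from t) w) <->
  has_chain up predT m.+1 w \/ has_chain up (extendible_right (~~ up) t) m w.
Proof.
rewrite -[t :: _]revK rev_cons -map_rev has_chain_rev has_chain_extend_right.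
by rewrite !has_chain_rev negbK.
Qed.

Lemma has_chain_leq up I m m' w :
  m <= m' -> has_chain up I m' w -> has_chain up I m w.
Proof.
move=> le_m [u [sub pw Iu szu]]; exists (take m u); split.
- exact: subseq_trans (take_subseq _ _) sub.
- exact: subseq_pairwise (take_subseq _ _) pw.
- by apply/allP=> x /mem_take; apply: (allP Iu).
- by rewrite size_takel // szu.
Qed.

Lemma has_chain_sub up (I I' : pred nat) m w :
  {in w, subpred I I'} -> has_chain up I m w -> has_chain up I' m w.
Proof.
move=> sI [u [sub pw Iu szu]]; exists u; split=> //.
by apply/allP=> x xu; apply: sI; [apply: mem_subseq xu | apply: (allP Iu)].
Qed.

Lemma has_chain_gt0 up I m w :
  0 < m -> has_chain up I m w -> exists2 x, x \in w & I x.
Proof.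
case: m => // m _ [[|x u] [//= sub _ /andP[Ix _] _]].
by exists x => //; apply: (mem_subseq sub); rewrite mem_head.
Qed.

(** * Crucial permutations *)

Lemma one_line_bounds n (s : 'S_n) x : x \in one_line s -> 0 < x <= n.
Proof. by case/mapP=> i _ ->; rewrite /= ltn_ord. Qed.

Lemma one_line_uniq n (s : 'S_n) : uniq (one_line s).
Proof.
rewrite map_inj_uniq ?enum_uniq // => i j /succn_inj/val_inj.
exact: perm_inj.
Qed.

Lemma size_one_line n (s : 'S_n) : size (one_line s) = n.
Proof. by rewrite size_map size_enum_ord. Qed.

Lemma rsk_spec n (s : 'S_n) (P Q : tableau) : rsk s = (P, Q) ->
  [/\ is_tableau P, perm_eq (reading P) (one_line s),
     chain_equiv (one_line s) (reading P) & map size P = map size Q].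
Proof.
move=> rskE; have := @rsk_fold_spec (one_line s) (iota 1 n) [::] [::].
rewrite -/(rsk s) rskE /=; apply=> //; first exact: one_line_uniq.
by rewrite size_one_line size_iota.
Qed.

Lemma has_chain_first_row T : is_tableau T ->
  has_chain true predT (num_cols T) (reading T).
Proof.
move=> tabT; apply/(full_increasing_chainP tabT) => //.
have in_top j : j < num_cols T -> in_shape T (0, j) by rewrite /num_cols -nth0.
exists (fun=> 0); split=> j lt_j; first by split; first exact: in_top.
exact: row_increasing (in_top _ lt_j) _.
Qed.

Lemma has_chain_first_col T : is_tableau T ->
  has_chain false predT (num_rows T) (reading T).
Proof.
move=> tabT; apply/(full_decreasing_chainP _ tabT).
have in_left i : i < num_rows T -> in_shape T (i, 0) by apply: rows_nonempty.
exists (fun=> 0); split=> i lt_i; first by split; first exact: in_left.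
by have [] := cols_dominate tabT (in_left _ lt_i).
Qed.

Lemma avoids_incrP T k : is_tableau T ->
  ~ has_chain true predT k.+1 (reading T) <-> num_cols T <= k.
Proof.
move=> tabT; split=> [no | le_k /(chain_le_cols tabT)]; last lia.
rewrite leqNgt; apply/negP=> lt_k; apply: no.
exact: has_chain_leq lt_k (has_chain_first_row tabT).
Qed.

Lemma avoids_decrP T l : is_tableau T ->
  ~ has_chain false predT l.+1 (reading T) <-> num_rows T <= l.
Proof.
move=> tabT; split=> [no | le_l /(chain_le_rows tabT)]; last lia.
rewrite leqNgt; apply/negP=> lt_l; apply: no.
exact: has_chain_leq lt_l (has_chain_first_col tabT).
Qed.

(** A covers the values above a, and B, if it covers a, covers all the
    others; as A misses a itself, the single value a decides. *)
Lemma threshold n a (A B : nat -> Prop) : 0 < a <= n ->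
  (forall t, A t <-> a < t) -> (forall t t', t <= t' -> B t' -> B t) ->
  (forall t : 'I_n.+1, A t.+1 \/ B t.+1) <-> B a.
Proof.
move=> /andP[a_gt0 a_le] Aa B_anti; split=> [AB | Ba t].
  have lt_a : a.-1 < n.+1 by lia.
  have := AB (Ordinal lt_a); rewrite /= prednK //.
  by case=> // /Aa; rewrite ltnn.
case: (ltnP a t.+1) => [lt_a | le_a]; first by left; apply/Aa.
by right; apply: B_anti Ba.
Qed.

(** The two extreme extensions, t = n + 1 and t = 1, leave a single
    alternative each, since no value exceeds n and none is below 1. *)
Lemma extremal_lengths n T up m1 m2 : {in reading T, forall x, 0 < x <= n} ->
  0 < m1 -> 0 < m2 ->
  (forall t : 'I_n.+1, has_chain up (gtn t.+1) m1 (reading T) \/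
                       has_chain (~~ up) (leq t.+1) m2 (reading T)) ->
  has_chain up predT m1 (reading T) /\ has_chain (~~ up) predT m2 (reading T).
Proof.
move=> bnd m1_gt0 m2_gt0 all_t; split.
  case: (all_t ord_max) => [|/(has_chain_gt0 m2_gt0)[x /bnd]]; last by move=> /=; lia.
  by apply: has_chain_sub.
case: (all_t ord0) => [/(has_chain_gt0 m1_gt0)[x /bnd] /=|]; first lia.
by apply: has_chain_sub.
Qed.

Section Crucial.

Variables (n k l : nat) (s : 'S_n) (T : tableau).
Hypotheses (n_gt0 : 0 < n) (tabT : is_tableau T).
Hypothesis permT : perm_eq (reading T) (one_line s).
Hypothesis equivT : chain_equiv (one_line s) (reading T).

Lemma reading_bounds : {in reading T, forall x, 0 < x <= n}.
Proof. by move=> x; rewrite (perm_mem permT); apply: one_line_bounds. Qed.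

Lemma cell_entry_bounds c : in_shape T c -> 0 < cell_entry T c <= n.
Proof.
move=> cT; apply: reading_bounds; rewrite -reading_cellsE map_f //.
by rewrite mem_reading_cells.
Qed.

Lemma nonempty_shape : 0 < num_rows T /\ 0 < num_cols T.
Proof.
have := perm_size permT; rewrite size_one_line.
case: T tabT => [|r T'] [] /=; last by [].
by rewrite /reading /= => /esym; lia.
Qed.

Lemma first_row_last_bounds : 0 < cell_entry T (0, (num_cols T).-1) <= n.
Proof.
have [_ C_gt0] := nonempty_shape.
by apply: cell_entry_bounds; rewrite /in_shape /= nth0 prednK.
Qed.

Lemma first_col_last_bounds : 0 < cell_entry T ((num_rows T).-1, 0) <= n.
Proof.
have [R_gt0 _] := nonempty_shape.
by apply/cell_entry_bounds/rows_nonempty; rewrite ?prednK.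
Qed.

Lemma convex_extendible up t : convex (extendible_right up t).
Proof. by move=> x y z; rewrite /extendible_right; case: up; lia. Qed.

Lemma has_chain_transfer up I m : convex I ->
  has_chain up I m (one_line s) <-> has_chain up I m (reading T).
Proof. exact: equivT. Qed.

Lemma avoids_incr_colsP : ~ contains_incr k.+1 s <-> num_cols T <= k.
Proof. by rewrite contains_incrP has_chain_transfer // avoids_incrP. Qed.

Lemma avoids_decr_rowsP : ~ contains_decr l.+1 s <-> num_rows T <= l.
Proof. by rewrite contains_decrP has_chain_transfer // avoids_decrP. Qed.

(** When s avoids both patterns, an occurrence in an extension uses the new
    letter. *)
Lemma right_crucial_readingP : right_crucial k.+1 l.+1 s <->
  [/\ num_cols T <= k, num_rows T <= l
    & forall t : 'I_n.+1, has_chain true (gtn t.+1) k (reading T) \/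
                          has_chain false (leq t.+1) l (reading T)].
Proof.
have ext (t : 'I_n.+1) : (contains_incr k.+1 (extend_right t s) \/
                          contains_decr l.+1 (extend_right t s)) <->
    ((has_chain true predT k.+1 (reading T) \/
      has_chain true (gtn t.+1) k (reading T)) \/
     (has_chain false predT l.+1 (reading T) \/
      has_chain false (leq t.+1) l (reading T))).
  rewrite contains_incrP contains_decrP one_line_extend_right.
  rewrite !has_chain_extend_right.
  by rewrite !has_chain_transfer //; apply: convex_extendible.
have no_incr := avoids_incrP k tabT; have no_decr := avoids_decrP l tabT.
split=> [[/avoids_incr_colsP le_k /avoids_decr_rowsP le_l all_t] | [le_k le_l all_t]].
  by split=> // t; have := all_t t; rewrite ext; tauto.
split; [exact/avoids_incr_colsP | exact/avoids_decr_rowsP | move=> t].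
by rewrite ext; have := all_t t; tauto.
Qed.

Lemma left_crucial_readingP : left_crucial k.+1 l.+1 s <->
  [/\ num_cols T <= k, num_rows T <= l
    & forall t : 'I_n.+1, has_chain false (gtn t.+1) l (reading T) \/
                          has_chain true (leq t.+1) k (reading T)].
Proof.
have ext (t : 'I_n.+1) : (contains_incr k.+1 (extend_left t s) \/
                          contains_decr l.+1 (extend_left t s)) <->
    ((has_chain true predT k.+1 (reading T) \/
      has_chain true (leq t.+1) k (reading T)) \/
     (has_chain false predT l.+1 (reading T) \/
      has_chain false (gtn t.+1) l (reading T))).
  rewrite contains_incrP contains_decrP one_line_extend_left.
  rewrite !has_chain_extend_left.
  by rewrite !has_chain_transfer //; apply: convex_extendible.
have no_incr := avoids_incrP k tabT; have no_decr := avoids_decrP l tabT.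
split=> [[/avoids_incr_colsP le_k /avoids_decr_rowsP le_l all_t] | [le_k le_l all_t]].
  by split=> // t; have := all_t t; rewrite ext; tauto.
split; [exact/avoids_incr_colsP | exact/avoids_decr_rowsP | move=> t].
by rewrite ext; have := all_t t; tauto.
Qed.

(** The extreme extensions force the dimensions of T, and then [first_rowP]
    supplies the value at which [threshold] applies. *)
Lemma right_crucialP : right_crucial k.+1 l.+1 s <->
  [/\ num_cols T = k, num_rows T = l
    & exists j, row_transversal T (leq (cell_entry T (0, k.-1))) j].
Proof.
have [R_gt0 C_gt0] := nonempty_shape; rewrite right_crucial_readingP.
have thr : num_cols T = k ->
    (forall t : 'I_n.+1, has_chain true (gtn t.+1) k (reading T) \/
                         has_chain false (leq t.+1) l (reading T)) <->
    has_chain false (leq (cell_entry T (0, k.-1))) l (reading T).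
  move=> Ck; rewrite -Ck.
  apply: (@threshold n _ (fun t => has_chain true (gtn t) (num_cols T) (reading T))
    (fun t => has_chain false (leq t) l (reading T))) => [|t|t t' le_t].
  - exact: first_row_last_bounds.
  - exact: first_rowP.
  by apply: has_chain_sub => x _; apply: leq_trans.
split=> [[le_k le_l all_t] | [Ck Rl trans]].
  have [incr_k decr_l] := extremal_lengths reading_bounds
    (leq_trans C_gt0 le_k) (leq_trans R_gt0 le_l) all_t.
  have Ck : num_cols T = k by apply/anti_leq; rewrite le_k (chain_le_cols tabT incr_k).
  have Rl : num_rows T = l by apply/anti_leq; rewrite le_l (chain_le_rows tabT decr_l).
  by split=> //; rewrite -full_decreasing_chainP // Rl -thr.
by rewrite Ck Rl; split=> //; rewrite thr // -Rl full_decreasing_chainP.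
Qed.

(** As for [right_crucialP], with the roles of increasing and decreasing chains
    exchanged: the end of the first column is now the decisive value. *)
Lemma left_crucialP : left_crucial k.+1 l.+1 s <->
  [/\ num_cols T = k, num_rows T = l
    & exists i, col_transversal T (leq (cell_entry T (l.-1, 0))) i].
Proof.
have [R_gt0 C_gt0] := nonempty_shape; rewrite left_crucial_readingP.
have conv t : convex (leq t) by move=> x y z /=; lia.
have thr : num_rows T = l ->
    (forall t : 'I_n.+1, has_chain false (gtn t.+1) l (reading T) \/
                         has_chain true (leq t.+1) k (reading T)) <->
    has_chain true (leq (cell_entry T (l.-1, 0))) k (reading T).
  move=> Rl; rewrite -Rl.
  apply: (@threshold n _ (fun t => has_chain false (gtn t) (num_rows T) (reading T))
    (fun t => has_chain true (leq t) k (reading T))) => [|t|t t' le_t].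
  - exact: first_col_last_bounds.
  - exact: first_colP.
  by apply: has_chain_sub => x _; apply: leq_trans.
split=> [[le_k le_l all_t] | [Ck Rl trans]].
  have [decr_l incr_k] := extremal_lengths reading_bounds
    (leq_trans R_gt0 le_l) (leq_trans C_gt0 le_k) all_t.
  have Ck : num_cols T = k by apply/anti_leq; rewrite le_k (chain_le_cols tabT incr_k).
  have Rl : num_rows T = l by apply/anti_leq; rewrite le_l (chain_le_rows tabT decr_l).
  by split=> //; rewrite -full_increasing_chainP // Ck -thr.
by rewrite Ck Rl; split=> //; rewrite thr // -Ck full_increasing_chainP.
Qed.

End Crucial.

(** An entry of the first row that is at least the last entry of that row is the
    last one; and if the first entry of an increasing sequence is at least a
    given value, so are all the others. *)
Lemma row_transversal_from_corner T k l : is_tableau T ->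
  num_cols T = k -> num_rows T = l -> 0 < l ->
  (exists j, row_transversal T (leq (cell_entry T (0, k.-1))) j) <->
  exists j : nat -> nat,
    [/\ j 1 = k,
        forall i, 1 <= i <= l -> is_cell T i (j i)
      & forall i, 1 <= i < l -> entry T i (j i) < entry T i.+1 (j i.+1)].
Proof.
move=> tabT Ck Rl l_gt0; rewrite /row_transversal /is_cell Rl.
split=> [[j [j_in j_inc]] | [j [j1 j_cell j_inc]]].
  exists (fun i => (j i.-1).+1); split=> [|[|i] //= lt_i|[|i] //= /j_inc //];
    last by rewrite lt_i; case: (j_in i lt_i).
  have [in0 le0] := j_in 0 l_gt0.
  have lt_k : j 0 < k by move: in0; rewrite /in_shape /= nth0 -/(num_cols T) Ck.
  have le_k : k.-1 <= j 0.
    apply: contraLR le0; rewrite -!ltnNge; apply: row_increasing => //.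
    by rewrite /in_shape /= nth0 -/(num_cols T) Ck; lia.
  by rewrite /=; lia.
pose j0 i := (j i.+1).-1.
have in_j0 i : i < l -> in_shape T (i, j0 i).
  by move=> /(j_cell i.+1) /andP[_ /andP[j_gt0]]; rewrite /in_shape /= prednK.
have inc_j0 i : i.+1 < l -> cell_entry T (i, j0 i) < cell_entry T (i.+1, j0 i.+1).
  by move=> lt_i; apply: j_inc.
exists j0; split=> [i lt_i | i /inc_j0 //]; split; first exact: in_j0.
rewrite -j1 /=; case: i lt_i => // i lt_i.
by apply/ltnW/(stepwise_increasing inc_j0).
Qed.

Lemma col_transversal_from_corner T k l : is_tableau T ->
  num_cols T = k -> num_rows T = l -> 0 < k ->
  (exists i, col_transversal T (leq (cell_entry T (l.-1, 0))) i) <->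
  exists i : nat -> nat,
    [/\ i 1 = l,
        forall j, 1 <= j <= k -> is_cell T (i j) j
      & forall j, 1 <= j < k -> entry T (i j) j < entry T (i j.+1) j.+1].
Proof.
move=> tabT Ck Rl k_gt0; rewrite /col_transversal /is_cell Ck Rl.
have lt_rows c : in_shape T c -> c.1 < l.
  by rewrite -Rl; apply: in_shape_row.
split=> [[i [i_in i_inc]] | [i [i1 i_cell i_inc]]].
  exists (fun j => (i j.-1).+1); split=> [|[|j] //= lt_j|[|j] //= /i_inc //].
    have [in0 le0] := i_in 0 k_gt0; have /= lt_l := lt_rows _ in0.
    have le_l : l.-1 <= i 0.
      apply: contraLR le0; rewrite -!ltnNge => lt_i.
      have in_l : in_shape T (l.-1, 0).
        by apply: (rows_nonempty tabT); rewrite -/(num_rows T) Rl /=; lia.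
      have [inS lt_S] := cols_dominate tabT (southeast tabT in_l lt_i (leqnn 0)).1.
      exact: leq_trans lt_S (southeast tabT in_l lt_i (leqnn 0)).2.
    by rewrite /=; lia.
  by have [inT _] := i_in j lt_j; have /= -> := lt_rows _ inT.
pose i0 j := (i j.+1).-1.
have i_gt0 j : j < k -> i j.+1 = (i0 j).+1.
  by move/(i_cell j.+1)=> /andP[/andP[i_gt0 _] _]; rewrite prednK.
have in_i0 j : j < k -> in_shape T (i0 j, j).
  by move/(i_cell j.+1)=> /andP[_ /andP[_]].
have inc_i0 j : j.+1 < k -> cell_entry T (i0 j, j) < cell_entry T (i0 j.+1, j.+1).
  by move=> lt_j; apply: i_inc.
exists i0; split=> [j lt_j | j /inc_i0 //]; split; first exact: in_i0.
rewrite -i1 /=; case: j lt_j => // j lt_j.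
by apply/ltnW/(stepwise_increasing inc_i0).
Qed.

Theorem theorem19 (k l n : nat) (hk : 0 < k) (hl : 0 < l) (hn : 0 < n)
    (s : 'S_n) (P Q : tableau) (hPQ : rsk s = (P, Q)) :
  bicrucial k l s <->
  [/\ num_cols P = k - 1 /\ num_cols Q = k - 1,
      num_rows P = l - 1 /\ num_rows Q = l - 1,
      exists j : nat -> nat,
        [/\ j 1 = k - 1,
            forall i, 1 <= i <= l - 1 -> is_cell P i (j i)
          & forall i, 1 <= i < l - 1 ->
              entry P i (j i) < entry P i.+1 (j i.+1)]
    & exists i : nat -> nat,
        [/\ i 1 = l - 1,
            forall j, 1 <= j <= k - 1 -> is_cell P (i j) j
          & forall j, 1 <= j < k - 1 ->
              entry P (i j) j < entry P (i j.+1) j.+1]].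
Proof.
have [tabP permP equivP shapePQ] := rsk_spec hPQ.
case: k hk => // k _; case: l hl => // l _; rewrite !subn1 /=.
have rowsQ : num_rows Q = num_rows P.
  by rewrite /num_rows -!(size_map size) shapePQ.
have colsQ : num_cols Q = num_cols P.
  have colsE T : num_cols T = head 0 (map size T) by case: T.
  by rewrite !colsE shapePQ.
have [R_gt0 C_gt0] := nonempty_shape hn tabP permP.
rewrite /bicrucial (right_crucialP k l hn tabP permP equivP).
rewrite (left_crucialP k l hn tabP permP equivP) rowsQ colsQ.
have corners : num_cols P = k -> num_rows P = l -> 0 < k /\ 0 < l.
  by move=> <- <-.
split=> [[[Ck Rl trR] [_ _ trC]] | [[Ck _] [Rl _] trR trC]].
all: have [k_gt0 l_gt0] := corners Ck Rl.
  split=> //; first exact/(row_transversal_from_corner tabP Ck Rl l_gt0).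
  exact/(col_transversal_from_corner tabP Ck Rl k_gt0).
split; split=> //; first exact/(row_transversal_from_corner tabP Ck Rl l_gt0).
exact/(col_transversal_from_corner tabP Ck Rl k_gt0).
Qed.
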